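(* For every ordinal $\alpha$ with $1\leqslant\alpha<\omega_1$, the ordered vector space $(V_\alpha,\leqslant_\alpha)$ defined in the context has almost Archimedeanization type $\lambda_{V_\alpha}=\alpha$.
   Context: All vector spaces are real, $\mathbb N=\{1,2,\dots\}$, and $\omega_1$ is the first uncountable ordinal. A pre-ordered vector space (POVS) is a vector space $X$ with a wedge $X_+$ (non-empty, closed under addition and under multiplication by scalars $t\ge0$); $x\le y$ iff $y-x\in X_+$. It is an ordered vector space (OVS) if $X_+\cap -X_+=\{0\}$. An order ideal of $X$ is a vector subspace $A$ such that $a\le x\le b$ with $a,b\in A$ implies $x\in A$; then $X/A$ is pre-ordered by the wedge $[X_+]=\{[x]:x\in X_+\}$. Infinitesimals: $N_X=\{x\in X:\exists\,\xi\in X_+\ \forall n\in\mathbb N\ \ \pm nx+\xi\in X_+\}$. Put $N_0(X)=\{0\}$ and, for every ordinal $\lambda>0$, with $M_\lambda=\bigcup_{\gamma<\lambda}N_\gamma(X)$, put $N_\lambda(X)=\{x\in X:[x]\in N_{X/M_\lambda}\}$ (all $N_\lambda(X)$ and $M_\lambda$ are order ideals of $X$). The almost Archimedeanization type $\lambda_X$ of $X$ is the first ordinal $\lambda$ such that $N_{\lambda+1}(X)=N_\lambda(X)$. Construction of $V_\alpha$: let $\mathcal P$ be the vector space of all real polynomials in one variable, and write $0\leqslant_1 p$ if $p=0$ or the leading coefficient of $p$ is positive. For each countable limit ordinal $\beta$ fix a strictly increasing cofinal sequence $A_\beta:\mathbb N\to\beta$ with values $\ge 1$ (so $A_\beta(n)<A_\beta(m)<\beta$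 for $n<m$ and $\lim_n A_\beta(n)=\beta$). For $1\leqslant\alpha<\omega_1$ let $V_\alpha=\bigoplus_{1\leqslant\beta\leqslant\alpha}\mathcal P$, and let $p_\beta$ denote the $\beta$-th coordinate of $p\in V_\alpha$. The order on $V_\alpha$ is given by $$0\leqslant_\alpha p\iff \text{for every }\beta\text{ with }1\leqslant\beta\leqslant\alpha:\ 0\leqslant_1 p_\beta\ \text{ and }\ p_\beta(n)\geqslant 0\text{ for all }n\in\mathbb N\text{ with }n\geqslant n_\beta(p),$$ where $n_1(p)=\infty$ (so the second condition is vacuous for $\beta=1$); $n_\beta(p)=\deg p_\gamma$ if $\beta=\gamma+1>1$ (with $\deg 0=-\infty$); and $n_\beta(p)=\min\{n\in\mathbb N: p_{A_\beta(n)}=0\}$ if $\beta$ is a limit ordinal. *)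

(* Defs.v *)
From HB Require Import structures.
From mathcomp Require Import all_boot all_order all_algebra.
From mathcomp Require Import generic_quotient ring_quotient.
From mathcomp Require Import all_classical all_reals ereal.
From mathcomp Require wochoice.

Set Implicit Arguments.
Unset Strict Implicit.
Unset Printing Implicit Defensive.

Import Order.TTheory GRing.Theory Num.Theory.

Local Open Scope classical_set_scope.
Local Open Scope quotient_scope.

(* Ordinals are the isomorphism types of well-ordered types. *)

Record wellOrder := WellOrder {
  wo_sort :> Type;
  wo_le : rel wo_sort;
  wo_leP : wochoice.well_order wo_le }.

HB.instance Definition _ := gen_eqMixin wellOrder.
HB.instance Definition _ := gen_choiceMixin wellOrder.

Definition wo_lt (W : wellOrder) : rel W := fun u v => ~~ wo_le v u.

Section WellOrderTheory.
Variable W : wellOrder.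
Implicit Types u v w : W.

Lemma wo_min (P : W -> Prop) : (exists u, P u) ->
  exists2 z, P z & forall u, P u -> wo_le z u.
Proof.
move=> [u Pu]; have [|z [[zP zle] _]] := @wo_leP W (fun v => `[< P v >]).
  by exists u; apply/asboolP.
exists z; first exact/asboolP.
by move=> v Pv; apply: zle; apply/asboolP.
Qed.

Lemma wo_total u v : wo_le u v || wo_le v u.
Proof.
have [|z [->|->] h] := @wo_min (fun w => w = u \/ w = v); first by exists u; left.
  by rewrite (h v) //; right.
by rewrite (h u) ?orbT //; left.
Qed.

Lemma wo_refl u : wo_le u u.
Proof. by have := wo_total u u; rewrite orbb. Qed.

Lemma wo_anti u v : wo_le u v -> wo_le v u -> u = v.
Proof.
move=> uv vu; have [|z [_ zU]] := @wo_leP W (fun w => `[< w = u \/ w = v >]).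
  by exists u; apply/asboolP; left.
have H w : wo_le w u -> wo_le w v -> (w = u \/ w = v) -> z = w.
  move=> wu wv e; apply: zU; split; first exact/asboolP.
  by move=> x /asboolP[->|->].
by rewrite -(H u) ?wo_refl //; [apply: H; rewrite ?wo_refl //; right|left].
Qed.

Lemma wo_trans u v w : wo_le u v -> wo_le v w -> wo_le u w.
Proof.
move=> uv vw.
have [|z [->|[->|->]] h] := @wo_min (fun x => x = u \/ x = v \/ x = w).
- by exists u; left.
- by apply: h; right; right.
- have /(wo_anti uv) e : wo_le v u by apply: h; left.
  by rewrite e.
- have /(wo_anti vw) e : wo_le w v by apply: h; right; left.
  by rewrite -e.
Qed.

Lemma wo_ltxx u : wo_lt u u = false.
Proof. by rewrite /wo_lt wo_refl. Qed.

Lemma wo_ltW u v : wo_lt u v -> wo_le u v.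
Proof. by rewrite /wo_lt; have /orP[->|->] := wo_total u v. Qed.

Lemma wo_lt_trans u v w : wo_lt u v -> wo_lt v w -> wo_lt u w.
Proof.
move=> /[dup] /wo_ltW uv; rewrite /wo_lt => nvu /wo_ltW vw.
by apply: contra nvu => wu; apply: wo_trans vw wu.
Qed.

Lemma wo_ltP u v : wo_lt u v \/ u = v \/ wo_lt v u.
Proof.
rewrite /wo_lt; have [vu|] := boolP (wo_le v u); last by left.
by have [uv|] := boolP (wo_le u v); right; [left; apply: wo_anti|right].
Qed.

Lemma wo_lt_wf : well_founded (@wo_lt W).
Proof.
move=> u; have [//|nu] := pselect (Acc (@wo_lt W) u).
have [|z nz zmin] := @wo_min (fun v => ~ Acc (@wo_lt W) v); first by exists u.
case: nz; constructor => v; rewrite /wo_lt => zv.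
have [//|/zmin] := pselect (Acc (@wo_lt W) v).
by rewrite (negPf zv).
Qed.

End WellOrderTheory.

Definition wo_iso : rel wellOrder := fun W U =>
  `[< exists2 f : W -> U, bijective f & {mono f : u v / wo_le u v} >].

Lemma wo_iso_equiv : equiv_class_of wo_iso.
Proof.
have sym W U : wo_iso W U -> wo_iso U W.
  move=> /asboolP[f [g fK gK] fm]; apply/asboolP; exists g; first by exists f.
  by move=> u v; rewrite -fm !gK.
split=> [W|W U|W U Z].
- by apply/asboolP; exists id => //; exists id.
- by apply/idP/idP; apply: sym.
- move=> /asboolP[f fb fm] /asboolP[g gb gm]; apply/asboolP.
  by exists (g \o f); [exact: bij_comp|move=> u v /=; rewrite gm fm].
Qed.

Canonical wo_iso_equivRel := EquivRelPack wo_iso_equiv.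
Canonical wo_iso_encModRel := defaultEncModRel wo_iso.

Definition Ord := {eq_quot wo_iso}.
HB.instance Definition _ : EqQuotient _ wo_iso Ord := EqQuotient.on Ord.
HB.instance Definition _ := Choice.on Ord.

Definition otype (W : wellOrder) : Ord := \pi_Ord W.

Lemma otype_eq (W U : wellOrder) : otype W = otype U <-> wo_iso W U.
Proof. by split=> [/eqmodP //|h]; apply/eqmodP. Qed.

Lemma otype_repr (a : Ord) : otype (repr a) = a.
Proof. exact: reprK. Qed.

Section Segment.
Variables (W : wellOrder) (u : W).

Lemma segment_subproof :
  wochoice.well_order (fun v w : {v : W | wo_lt v u} => wo_le (val v) (val w)).
Proof.
move=> A [x Ax].
have [|z [hz Az] zmin] := @wo_min W (fun v => exists h : wo_lt v u, exist _ v h \in A).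
  by case: x Ax => v h Ax; exists v, h.
exists (exist _ z hz); split.
  by split=> // -[v h] Av; apply: zmin; exists h.
move=> [y hy] [Ay ylb]; apply: val_inj; apply: wo_anti => /=.
  by apply: zmin; exists hy.
exact: (ylb _ Az).
Qed.

Definition segment := WellOrder segment_subproof.

End Segment.

Definition olt : rel Ord := fun a b =>
  `[< exists u : repr b, a = otype (segment u) >].

Lemma iso_segment (W U : wellOrder) (f : W -> U) (u : W) :
  bijective f -> {mono f : v w / wo_le v w} ->
  otype (segment u) = otype (segment (f u)).
Proof.
move=> [g fK gK] fm; apply/otype_eq/asboolP.
have f_lt v w : wo_lt (f v) (f w) = wo_lt v w by rewrite /wo_lt fm.
pose F (v : segment u) : segment (f u) :=
  exist _ (f (val v)) (etrans (f_lt _ _) (valP v)).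
have Gp (v : segment (f u)) : wo_lt (g (val v)) u.
  by rewrite -f_lt gK; exact: (svalP v).
pose G (v : segment (f u)) : segment u := exist _ (g (val v)) (Gp v).
exists F; last by move=> v w; rewrite /= fm.
by exists G => v; apply: val_inj; rewrite /= ?fK ?gK.
Qed.

Lemma oltP (a : Ord) (W : wellOrder) :
  reflect (exists u : W, a = otype (segment u)) (olt a (otype W)).
Proof.
have /otype_eq/asboolP W_iso := otype_repr (otype W).
apply: (iffP (asboolP _)) => -[u ->]; have [f fb fm] := W_iso.
  by exists (f u); apply: iso_segment.
have [g fK gK] := fb; exists (g u).
by rewrite (iso_segment (g u) fb fm) gK.
Qed.

Lemma segment_segment (W : wellOrder) (u : W) (v : segment u) :
  otype (segment v) = otype (segment (val v)).
Proof.
apply/otype_eq/asboolP.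
have Fp (w : segment v) : wo_lt (val (val w)) (val v) := valP w.
pose F (w : segment v) : segment (val v) := exist _ (val (val w)) (Fp w).
have Gp (w : segment (val v)) : wo_lt (val w) u.
  exact: wo_lt_trans (valP w) (valP v).
pose G (w : segment (val v)) : segment v :=
  exist _ (exist _ (val w) (Gp w) : segment u) (valP w).
exists F => //.
by exists G => w; [apply: val_inj; apply: val_inj|apply: val_inj].
Qed.

Lemma olt_segment (W : wellOrder) (v u : W) :
  wo_lt v u -> olt (otype (segment v)) (otype (segment u)).
Proof.
move=> vu; apply/oltP; exists (exist _ v vu : segment u).
by rewrite segment_segment.
Qed.

Lemma olt_wf : well_founded (fun a b => olt a b).
Proof.
have H (W : wellOrder) (u : W) : Acc (fun a b => olt a b) (otype (segment u)).
  elim: u / (wo_lt_wf u) => u _ IH; constructor => a /oltP[v ->].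
  by rewrite segment_segment; apply: IH; exact: (svalP v).
move=> a; rewrite -(otype_repr a); constructor => b /oltP[u ->]; exact: H.
Qed.

Lemma olt_irr : irreflexive olt.
Proof.
move=> a; elim: a / (olt_wf a) => a _ IH; apply/negP => aa.
by have := IH a aa; rewrite aa.
Qed.

Lemma olt_trans : transitive olt.
Proof.
move=> b a c; rewrite -(otype_repr c) => ab /oltP[u eb].
move: ab; rewrite eb => /oltP[v ->]; apply/oltP.
by rewrite segment_segment; exists (val v).
Qed.

Lemma olt_ext (a b : Ord) : (forall c, olt c a = olt c b) -> a = b.
Proof.
rewrite -(otype_repr a) -(otype_repr b).
move: (repr a) (repr b) => W U {a b} h; apply/otype_eq/asboolP.
have seg_inj (Z : wellOrder) (u v : Z) :
    otype (segment u) = otype (segment v) -> u = v.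
  by have [/olt_segment + e|[//|/olt_segment + e]] := wo_ltP u v;
    rewrite e olt_irr.
have seg_le (Z Z' : wellOrder) (u v : Z) (u' v' : Z') :
    otype (segment u) = otype (segment u') ->
    otype (segment v) = otype (segment v') -> wo_le u v = wo_le u' v'.
  suff H (Y Y' : wellOrder) (x y : Y) (x' y' : Y') :
      otype (segment x) = otype (segment x') ->
      otype (segment y) = otype (segment y') -> wo_lt x y -> wo_lt x' y'.
    move=> eu ev; apply: negb_inj; apply/idP/idP; exact: H.
  move=> ex ey /olt_segment; rewrite ex ey => lt.
  have [//|[e|/olt_segment gt]] := wo_ltP x' y'.
    by rewrite e olt_irr in lt.
  by have := olt_trans lt gt; rewrite olt_irr.
have F (w : W) : {u : U | otype (segment w) = otype (segment u)}.
  by apply: cid; apply/oltP; rewrite -h; apply/oltP; exists w.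
have G (u : U) : {w : W | otype (segment u) = otype (segment w)}.
  by apply: cid; apply/oltP; rewrite h; apply/oltP; exists u.
exists (fun w : W => sval (F w)).
  exists (fun u : U => sval (G u)) => x; apply: seg_inj.
    by rewrite -(svalP (G _)) -(svalP (F _)).
  by rewrite -(svalP (F _)) -(svalP (G _)).
by move=> v w /=; apply: seg_le; rewrite -(svalP (F _)).
Qed.

Lemma olt_total (a b : Ord) : a != b -> olt a b || olt b a.
Proof.
elim: a / (olt_wf a) b => a _ IHa b.
elim: b / (olt_wf b) => b _ IHb.
case: (boolP (olt a b)) => //= nab; case: (boolP (olt b a)) => //= nba /negP[].
apply/eqP/olt_ext => c; apply/idP/idP => hc.
- have [e|nc] := eqVneq c b; first by rewrite -e hc in nba.
  have /orP[//|bc] := IHa c hc b nc.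
  by rewrite (olt_trans bc hc) in nba.
- have [e|nc] := eqVneq a c; first by rewrite e hc in nab.
  have /orP[ac|//] := IHb c hc nc.
  by rewrite (olt_trans ac hc) in nab.
Qed.

Fact Ord_display : Order.disp_t. Proof. exact: Order.Disp tt tt. Qed.
HB.instance Definition _ :=
  Order.Lt_isPOrder.Build Ord_display Ord olt_irr olt_trans.
Lemma Ord_total : total (<=%O : rel Ord).
Proof.
move=> a b; rewrite !le_eqVlt; have [//|nab] := eqVneq a b.
exact: olt_total.
Qed.
HB.instance Definition _ := Order.POrder_isTotal.Build Ord_display Ord Ord_total.

Lemma Ord_lt_wf : well_founded (fun a b : Ord => (a < b)%O).
Proof. exact: olt_wf. Qed.

Lemma empty_subproof : wochoice.well_order (fun _ _ : void => true).
Proof. by move=> A [[]]. Qed.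

Definition ozero : Ord := otype (WellOrder empty_subproof).

Lemma ozero_le (a : Ord) : (ozero <= a)%O.
Proof. by rewrite leNgt; apply/negP => /oltP[[]]. Qed.

Section SuccessorOrder.
Variable W : wellOrder.

(* W with a new top element None. *)
Definition succ_le : rel (option W) := fun x y =>
  match x, y with
  | _, None => true
  | None, Some _ => false
  | Some u, Some v => wo_le u v
  end.

Lemma succ_subproof : wochoice.well_order succ_le.
Proof.
move=> A [x Ax].
have [[u Au]|noA] := pselect (exists u, Some u \in A).
  have [|z Az zmin] := @wo_min W (fun u => Some u \in A); first by exists u.
  exists (Some z); split; first by split=> // -[v|//] Av; apply: zmin.
  move=> [v|] [Av vlb]; last by have := vlb _ Az.
  by congr Some; apply: wo_anti; [apply: zmin|apply: (vlb _ Az)].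
have A_None y : y \in A -> y = None by case: y => // u Au; case: noA; exists u.
exists None; split; first by rewrite -(A_None x) //; split=> // y /A_None ->; rewrite (A_None x).
by move=> y [/A_None ->].
Qed.

Definition succ_wo := WellOrder succ_subproof.

Lemma otype_segment_None : otype (segment (None : succ_wo)) = otype W.
Proof.
apply/otype_eq; rewrite (equiv_sym wo_iso_equivRel); apply/asboolP.
have Fp (w : W) : wo_lt (Some w : succ_wo) None by [].
exists (fun w : W => exist _ (Some w) (Fp w) : segment (None : succ_wo)) => //.
have Gp (w : segment (None : succ_wo)) : {v : W | val w = Some v}.
  by case: w => -[v|] h; [exists v|exfalso].
exists (fun w => sval (Gp w)) => w; last first.
  by apply: val_inj; rewrite /= -(svalP (Gp w)).
by case: (Gp _) => v /= [].
Qed.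

Lemma otype_segment_Some (u : W) :
  otype (segment (Some u : succ_wo)) = otype (segment u).
Proof.
apply/otype_eq; rewrite (equiv_sym wo_iso_equivRel); apply/asboolP.
have Fp (w : segment u) : wo_lt (Some (val w) : succ_wo) (Some u) := svalP w.
exists (fun w : segment u =>
  exist _ (Some (val w)) (Fp w) : segment (Some u : succ_wo)) => //.
have Gp (w : segment (Some u : succ_wo)) : {v : segment u | val w = Some (val v)}.
  by case: w => -[v|] h //; exists (exist _ v h).
exists (fun w => sval (Gp w)) => w; last first.
  by apply: val_inj; rewrite /= -(svalP (Gp w)).
by case: (Gp _) => v /= [e]; apply: val_inj.
Qed.

End SuccessorOrder.

Definition osucc (a : Ord) : Ord := otype (succ_wo (repr a)).

Lemma lt_osucc (a b : Ord) : (b < osucc a)%O = (b <= a)%O.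
Proof.
have e := otype_repr a; apply/idP/idP => [/oltP[[u|] ->]|].
- by rewrite otype_segment_Some -[leRHS]e; apply: ltW; apply/oltP; exists u.
- by rewrite otype_segment_None e.
rewrite le_eqVlt => /orP[/eqP ->|].
  by apply/oltP; exists None; rewrite otype_segment_None e.
rewrite -{1}e => /oltP[u ->]; apply/oltP; exists (Some u).
by rewrite otype_segment_Some.
Qed.

Lemma osucc_le (a b : Ord) : (osucc a <= b)%O = (a < b)%O.
Proof. by rewrite leNgt lt_osucc -ltNge. Qed.

Definition oone : Ord := osucc ozero.

Definition is_limit (b : Ord) : Prop :=
  b <> ozero /\ forall c, b <> osucc c.

(* As omega_1 is the first uncountable ordinal, this says b < omega_1. *)
Definition countable_ord (b : Ord) : Prop := countable [set c : Ord | (c < b)%O].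

(* The terms of the sequence are s n for n >= 1. *)
Definition cofinal_seq (b : Ord) (s : nat -> Ord) : Prop :=
  [/\ forall n, (0 < n)%N -> (oone <= s n < b)%O,
      forall m n, (0 < m < n)%N -> (s m < s n)%O &
      forall c, (c < b)%O -> exists2 n, (0 < n)%N & (c <= s n)%O].

Local Open Scope ring_scope.

Record povs (R : realType) := POVS {
  povs_sort :> lmodType R;
  wedge : set povs_sort;
  wedge_nonempty : wedge !=set0;
  wedgeD : forall x y, wedge x -> wedge y -> wedge (x + y);
  wedgeZ : forall t x, 0 <= t -> wedge x -> wedge (t *: x) }.

Definition is_ovs (R : realType) (X : povs R) : Prop :=
  [set x : X | wedge x /\ wedge (- x)] = [set 0].

Definition infinitesimals (R : realType) (X : povs R) : set X :=
  [set x | exists2 xi : X, wedge xi &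
    forall n, (0 < n)%N -> wedge (x *+ n + xi) /\ wedge (- x *+ n + xi)].

Section QuotientSpace.
Variables (R : realType) (V : lmodType R) (M : set V).

Definition lspan : {pred V} := fun x =>
  `[< forall A : {pred V}, submod_closed A -> (forall y, M y -> y \in A) ->
      x \in A >].

Lemma lspan_closed : submod_closed lspan.
Proof.
split=> [|a x y /asboolP hx /asboolP hy]; apply/asboolP => A cA MA.
  by case: cA.
by case: (cA) => _; apply; [apply: hx|apply: hy].
Qed.
HB.instance Definition _ := GRing.isSubmodClosed.Build R V lspan lspan_closed.

Lemma sub_lspan x : M x -> x \in lspan.
Proof. by move=> Mx; apply/asboolP => A _; apply. Qed.

Lemma lspan_id : submod_closed (fun x => `[< M x >]) ->
  forall x, (x \in lspan) = `[< M x >].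
Proof.
move=> cM x; apply/idP/asboolP => [/asboolP h|]; last exact: sub_lspan.
by apply/asboolP; apply: (h (fun x => `[< M x >])) => // y My; apply/asboolP.
Qed.

(* The quotient V / M when M is a vector subspace; taking the span makes the
   construction total in M. *)
Definition quotmod := {ideal_quot lspan}.
HB.instance Definition _ := GRing.Zmodule.on quotmod.

Definition quotmod_pi (x : V) : quotmod := \pi_({ideal_quot lspan}) x.

Definition quotmod_scale (a : R) (x : quotmod) : quotmod :=
  quotmod_pi (a *: repr (x : {ideal_quot lspan})).

Lemma quotmod_eq x y : (quotmod_pi x == quotmod_pi y) = (x - y \in lspan).
Proof. by rewrite Quotient.idealrBE. Qed.

Lemma quotmod_reprK (x : quotmod) : quotmod_pi (repr (x : {ideal_quot lspan})) = x.
Proof. exact: reprK. Qed.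

Lemma quotmod_piD x y : quotmod_pi (x + y) = quotmod_pi x + quotmod_pi y.
Proof. exact: Quotient.pi_add. Qed.

Lemma quotmod_piZ a x : quotmod_pi (a *: x) = quotmod_scale a (quotmod_pi x).
Proof.
apply/eqP; rewrite quotmod_eq -scalerBr rpredZ // -quotmod_eq.
by rewrite quotmod_reprK.
Qed.

Fact quotmod_scaleA a b x :
  quotmod_scale a (quotmod_scale b x) = quotmod_scale (a * b) x.
Proof. by rewrite -(quotmod_reprK x) -!quotmod_piZ scalerA. Qed.
Fact quotmod_scale1 : left_id 1 quotmod_scale.
Proof. by move=> x; rewrite -(quotmod_reprK x) -quotmod_piZ scale1r. Qed.
Fact quotmod_scaleDr : right_distributive quotmod_scale +%R.
Proof.
move=> a x y; rewrite -(quotmod_reprK x) -(quotmod_reprK y).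
by rewrite -quotmod_piD -!quotmod_piZ -quotmod_piD scalerDr.
Qed.
Fact quotmod_scaleDl x : {morph quotmod_scale^~ x : a b / a + b}.
Proof.
by move=> a b /=; rewrite -(quotmod_reprK x) -!quotmod_piZ -quotmod_piD scalerDl.
Qed.
HB.instance Definition _ := GRing.Zmodule_isLmodule.Build R quotmod
  quotmod_scaleA quotmod_scale1 quotmod_scaleDr quotmod_scaleDl.

End QuotientSpace.

Section QuotientPovs.
Variables (R : realType) (X : povs R) (M : set X).

Definition quotient_wedge : set (quotmod M) :=
  [set quotmod_pi M x | x in @wedge R X].

Lemma quotient_wedge_nonempty : quotient_wedge !=set0.
Proof. by have [x hx] := wedge_nonempty X; exists (quotmod_pi M x); exists x. Qed.

Lemma quotient_wedgeD x y :
  quotient_wedge x -> quotient_wedge y -> quotient_wedge (x + y).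
Proof.
move=> [u hu <-] [v hv <-]; exists (u + v); first exact: wedgeD.
exact: quotmod_piD.
Qed.

Lemma quotient_wedgeZ (t : R) x :
  0 <= t -> quotient_wedge x -> quotient_wedge (t *: x).
Proof.
move=> t0 [u hu <-]; exists (t *: u); first exact: wedgeZ.
exact: quotmod_piZ.
Qed.

Definition quotient : povs R :=
  POVS quotient_wedge_nonempty quotient_wedgeD quotient_wedgeZ.

End QuotientPovs.

Section InfinitesimalHierarchy.
Variables (R : realType) (X : povs R).

Definition infinitesimals_mod (M : set X) : set X :=
  [set x | infinitesimals (X := quotient M) (quotmod_pi M x)].

Definition N_iter : Ord -> set X :=
  Fix Ord_lt_wf (fun=> set X) (fun l N =>
    if l == ozero then [set 0]
    else infinitesimals_mod
      [set x | exists g, exists h : (g < l)%O, N g h x]).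

Definition M_iter (l : Ord) : set X :=
  \bigcup_(g in [set g | (g < l)%O]) N_iter g.

Lemma N_iterE l :
  N_iter l = if l == ozero then [set 0] else infinitesimals_mod (M_iter l).
Proof.
rewrite {1}/N_iter Fix_eq => [|{}l f g fg].
  case: ifP => // _; congr infinitesimals_mod; apply/seteqP.
  by split=> x [g]; [case=> h Nx; exists g|move=> h Nx; exists g, h].
case: ifP => // _; congr infinitesimals_mod; apply/seteqP.
by split=> x [c [h]]; [rewrite fg|rewrite -fg]; exists c, h.
Qed.

End InfinitesimalHierarchy.

Arguments N_iter {R} X l.
Arguments M_iter {R} X l.

Section HierarchySubspaces.
Variables (R : realType).

Lemma infinitesimals_submod (X : povs R) :
  submod_closed (fun x : X => `[< infinitesimals x >]).
Proof.
split=> [|a x y /asboolP[xi hxi hx] /asboolP[eta heta hy]]; apply/asboolP.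
  have [xi hxi] := wedge_nonempty X; exists xi => // n _.
  by rewrite oppr0 !mul0rn add0r.
exists (`|a| *: xi + eta).
  by apply: wedgeD => //; apply: wedgeZ.
move=> n n0; have [hx1 hx2] := hx n n0; have [hy1 hy2] := hy n n0.
have H u v : wedge (u *+ n + xi) -> wedge (v *+ n + eta) ->
    wedge ((`|a| *: u + v) *+ n + (`|a| *: xi + eta)).
  move=> hu hv; rewrite mulrnDl addrACA scalerMnr -scalerDr.
  by apply: wedgeD => //; apply: wedgeZ.
have [a0|a0] := leP 0 a.
  split; first by have := H x y hx1 hy1; rewrite ger0_norm.
  by have := H _ _ hx2 hy2; rewrite ger0_norm // opprD scalerN.
split; first by have := H _ _ hx2 hy1; rewrite ltr0_norm // scalerN scaleNr opprK.
by have := H _ _ hx1 hy2; rewrite ltr0_norm // scaleNr -opprD.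
Qed.

Lemma infinitesimals_mod_submod (X : povs R) (M : set X) :
  submod_closed (fun x : X => `[< infinitesimals_mod M x >]).
Proof.
have [h0 hl] := infinitesimals_submod (quotient M).
have pi0 : quotmod_pi M 0 = 0.
  by rewrite -[X in quotmod_pi _ X](scale0r 0) quotmod_piZ; apply: scale0r.
split=> [|a x y hx hy].
  by apply/asboolP; rewrite /infinitesimals_mod /= pi0; apply/asboolP.
have := hl a _ _ hx hy; rewrite /in_mem /= /infinitesimals_mod /=.
by rewrite quotmod_piD quotmod_piZ.
Qed.

Lemma sub_infinitesimals_mod (X : povs R) (M : set X) :
  M `<=` infinitesimals_mod M.
Proof.
have [/asboolP h0 _] := infinitesimals_mod_submod M.
move=> x Mx; rewrite /infinitesimals_mod /=.
suff -> : quotmod_pi M x = quotmod_pi M 0 by [].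
by apply/eqP; rewrite quotmod_eq subr0 sub_lspan.
Qed.

Variable X : povs R.

Lemma N_iter0 : N_iter X ozero = [set 0].
Proof. by rewrite N_iterE eqxx. Qed.

Lemma N_iter_gt0 (l : Ord) : (ozero < l)%O ->
  N_iter X l = infinitesimals_mod (M_iter X l).
Proof. by move=> l0; rewrite N_iterE gt_eqF. Qed.

Lemma N_iter_submod (l : Ord) :
  submod_closed (fun x : X => `[< N_iter X l x >]).
Proof.
rewrite N_iterE; case: eqP => _; last exact: infinitesimals_mod_submod.
split=> [|a x y /asboolP-> /asboolP->]; apply/asboolP => //=.
by rewrite scaler0 addr0.
Qed.

Lemma N_iter_mono (g l : Ord) : (g <= l)%O -> N_iter X g `<=` N_iter X l.
Proof.
rewrite le_eqVlt => /orP[/eqP -> //|gl] x Nx.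
rewrite N_iter_gt0 ?(le_lt_trans (ozero_le g)) //.
by apply: sub_infinitesimals_mod; exists g.
Qed.

Lemma M_iter_submod (l : Ord) : (ozero < l)%O ->
  submod_closed (fun x : X => `[< M_iter X l x >]).
Proof.
move=> l0; split=> [|a x y /asboolP[g /= gl gx] /asboolP[h /= hl hy]].
  by apply/asboolP; exists ozero => //; rewrite N_iter0.
apply/asboolP; exists (Order.max g h); first by rewrite /= gt_max gl.
have [_ H] := N_iter_submod (Order.max g h); apply/asboolP; apply: H.
  by apply/asboolP; apply: N_iter_mono gx; rewrite le_max lexx.
by apply/asboolP; apply: N_iter_mono hy; rewrite le_max lexx orbT.
Qed.

End HierarchySubspaces.

Definition is_aa_type (R : realType) (X : povs R) (l : Ord) : Prop :=
  N_iter X (osucc l) = N_iter X l /\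
  forall m : Ord, (m < l)%O -> N_iter X (osucc m) <> N_iter X m.

Section DirectSum.
Variables (R : realType) (alpha : Ord).

(* The direct sum of copies of {poly R} indexed by 1 <= b <= alpha, as the
   finitely supported families on Ord that vanish outside of [1, alpha]. *)
Definition direct_sum : {pred Ord -> {poly R}} := fun p =>
  `[< finite_set [set b | p b != 0] /\
      forall b, p b != 0 -> (oone <= b <= alpha)%O >].

Lemma direct_sum_closed : submod_closed direct_sum.
Proof.
split=> [|a p q /asboolP[fp ip] /asboolP[fq iq]]; apply/asboolP; split.
- rewrite (_ : [set _ | _] = set0) //.
  by apply/seteqP; split=> b //=; rewrite eqxx.
- by move=> b; rewrite eqxx.
- apply: sub_finite_set (_ : _ `<=` [set b | p b != 0] `|` [set b | q b != 0]) _.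
    move=> b /=; have [pb|] := eqVneq (p b) 0; last by left.
    have [qb|] := eqVneq (q b) 0; last by right.
    by rewrite /GRing.add/= /GRing.scale/= pb qb scaler0 addr0 eqxx.
  by rewrite finite_setU.
- move=> b; have [pb|/ip //] := eqVneq (p b) 0.
  have [qb|/iq //] := eqVneq (q b) 0.
  by rewrite /GRing.add/= /GRing.scale/= pb qb scaler0 addr0 eqxx.
Qed.
HB.instance Definition _ :=
  GRing.isSubmodClosed.Build R (Ord -> {poly R}) direct_sum direct_sum_closed.

Record V_space := VSpace {
  V_coord :> Ord -> {poly R};
  _ : V_coord \in direct_sum }.
HB.instance Definition _ := [isSub for V_coord].
HB.instance Definition _ := [Choice of V_space by <:].
HB.instance Definition _ := [SubChoice_isSubLmodule of V_space by <:].

End DirectSum.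

Section OrderV.
Variable R : realType.

Definition le1_poly (q : {poly R}) : Prop := q = 0 \/ 0 < lead_coef q.

Definition edeg (q : {poly R}) : \bar R :=
  if q == 0 then -oo%E else (size q).-1%:R%:E.

Variable A : Ord -> nat -> Ord.

(* n_b(p). In the limit case the infimum is a minimum when A b is injective and
   p has finite support. *)
Definition threshold (b : Ord) (p : Ord -> {poly R}) : \bar R :=
  if b == oone then +oo%E else
  match pselect (exists c, b = osucc c) with
  | left b_succ => edeg (p (sval (cid b_succ)))
  | right _ =>
      ereal_inf [set n%:R%:E | n in [set n | (0 < n)%N /\ p (A b n) = 0]]
  end.

Variable alpha : Ord.

Definition V_wedge : set (V_space R alpha) := [set p |
  forall b : Ord, (oone <= b <= alpha)%O ->
    le1_poly (p b) /\
    forall n, (0 < n)%N -> (threshold b p <= n%:R%:E)%E -> 0 <= (p b).[n%:R]].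

Lemma le1_polyD (q r : {poly R}) : le1_poly q -> le1_poly r ->
  le1_poly (q + r) /\ size (q + r) = maxn (size q) (size r).
Proof.
case=> [-> hr|hq]; first by rewrite add0r size_poly0 max0n.
case=> [->|hr]; first by rewrite addr0 size_poly0 maxn0; split=> //; right.
have [lt|lt|e] := ltngtP (size q) (size r).
- rewrite /le1_poly addrC size_polyDl // lead_coefDl //; split=> //; by right.
- by rewrite /le1_poly size_polyDl // lead_coefDl //; split=> //; right.
have c : 0 < (q + r)`_(size q).-1.
  by rewrite coefD {2}e addr_gt0 // -?lead_coefE.
have q0 : (0 < size q)%N.
  by rewrite size_poly_gt0 -lead_coef_eq0 gt_eqF.
have s : size (q + r) = size q.
  apply/eqP; rewrite eqn_leq; apply/andP; split.
    by rewrite (leq_trans (size_polyD _ _)) // -e maxnn.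
  rewrite leqNgt; apply/negP => lt; move: c.
  by rewrite nth_default ?ltxx // -ltnS prednK.
by split=> //; right; rewrite lead_coefE s.
Qed.

Lemma edegE (q : {poly R}) : (edeg q = if size q is n.+1 then n%:R%:E else -oo)%E.
Proof. by rewrite /edeg -size_poly_eq0; case: (size q). Qed.

Lemma thresholdD b (p q : V_space R alpha) : V_wedge p -> V_wedge q ->
  (threshold b p <= threshold b (p + q)%R)%E.
Proof.
move=> hp hq.
have H c : le1_poly (p c) /\ le1_poly (q c).
  case: (boolP (oone <= c <= alpha)%O) => hc.
    by split; [case: (hp c hc)|case: (hq c hc)].
  have K (r : V_space R alpha) : r c = 0.
    case: r => r /= /asboolP[_ /(_ c)].
    by case: (r c =P 0) => // _ /(_ isT) e; rewrite e in hc.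
  by split; left; apply: K.
have HD c : size ((p + q) c) = maxn (size (p c)) (size (q c)).
  by have [_] := le1_polyD (H c).1 (H c).2.
rewrite /threshold; case: ifP => // _; case: pselect => [e|_].
  rewrite !edegE HD; case: (size (p _)) => [|m]; first by rewrite leNye.
  by case: (size (q _)) => [|k]; rewrite ?maxn0 // maxnSS lee_fin ler_nat leq_maxl.
apply: le_ereal_inf => _ [n [n0 /eqP pq] <-]; exists n => //; split=> //.
by move: pq; rewrite -size_poly_eq0 HD -leqn0 geq_max !leqn0 size_poly_eq0 => /andP[/eqP].
Qed.

Lemma V_wedge_nonempty : V_wedge !=set0.
Proof. by exists 0 => b _; split=> [|n _ _]; [left|rewrite horner0]. Qed.

Lemma V_wedgeD p q : V_wedge p -> V_wedge q -> V_wedge (p + q).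
Proof.
move=> hp hq b hb; have [pb pn] := hp b hb; have [qb qn] := hq b hb.
split=> [|n n0 hn]; first by have [] := le1_polyD pb qb.
have -> : (p + q) b = p b + q b by [].
rewrite hornerD addr_ge0 //.
  by apply: pn => //; apply: le_trans hn; apply: thresholdD.
by apply: qn => //; apply: le_trans hn; rewrite addrC; apply: thresholdD.
Qed.

Lemma V_wedgeZ t p : 0 <= t -> V_wedge p -> V_wedge (t *: p).
Proof.
rewrite le_eqVlt => /orP[/eqP <- _|t0 hp b hb].
  by rewrite scale0r => b _; split=> [|n _ _]; [left|rewrite horner0].
have E c : (t *: p) c = t *: p c by [].
have [pb pn] := hp b hb; split=> [|n n0 hn].
  rewrite E; case: pb => [->|pb]; first by left; rewrite scaler0.
  by right; rewrite lead_coefZ mulr_gt0.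
rewrite E hornerZ mulr_ge0 ?(ltW t0) //; apply: pn => //; move: hn.
rewrite /threshold; case: ifP => // _; case: pselect => [e|_].
  by rewrite !edegE E size_scale ?gt_eqF.
congr (_ <= _)%E; congr ereal_inf; congr (_ @` _); apply/seteqP.
split=> m [m0 e]; split=> //; rewrite ?E ?e ?scaler0 //.
by move/eqP: e; rewrite E scaler_eq0 gt_eqF //= => /eqP.
Qed.

Definition V : povs R := POVS V_wedge_nonempty V_wedgeD V_wedgeZ.

Lemma V_ovs : is_ovs V.
Proof.
apply/seteqP; split=> p; last first.
  move=> -> /=; rewrite oppr0; split; have [q hq] := V_wedge_nonempty;
  by rewrite -(scale0r q); apply: V_wedgeZ.
move=> [hp hn] /=; apply: val_inj; apply/funext => b /=.
case: (boolP (oone <= b <= alpha)%O) => hb; last first.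
  case: p {hp hn} => p /= /asboolP[_ /(_ b)].
  by case: (p b =P 0) => // _ /(_ isT) e; rewrite e in hb.
have [[//|pos] _] := hp b hb; have [neg _] := hn b hb.
have E : (- p : V_space R alpha) b = - p b by [].
move: neg; rewrite E => -[/eqP|]; first by rewrite oppr_eq0 => /eqP.
by rewrite lead_coefN oppr_gt0 ltNge ltW.
Qed.

End OrderV.

Arguments V R A alpha : clear implicits.

(* Main.v *)
Require Import Defs.
From mathcomp Require Import all_boot all_order all_algebra.
From mathcomp Require Import all_classical all_reals.
From mathcomp Require Import ereal.
From mathcomp Require polyrcf.

(** For l <= alpha the hierarchy of infinitesimals is explicit: N_l(V_alpha)
    consists of the vectors whose coordinates of index b > l all vanish
    ([N_iter_supp]). The hierarchy therefore exhausts V_alpha at alpha, and for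
    m < alpha the unit vector at the coordinate m + 1 separates N_(m + 1) from
    N_m, so that the type is alpha.

    The formula is proved by strong induction on l. By the induction hypothesis
    and the finiteness of supports, M_l is the space of the vectors supported
    below l, for successor and limit l alike ([M_iter_supp]). So x lies in N_l
    iff some positive xi makes every n x + xi and every - n x + xi positive
    after a modification of their coordinates below l
    ([infinitesimals_modP]).

    If x is supported in [1, l], take for xi a monomial of degree greater than
    that of x_l, placed at l. The l-th coordinate of n x + xi is then eventually
    nonnegative, from an integer K that may depend on n. It is harmless for it
    to be negative before K, since the coordinates below l can be chosen so as
    to raise the threshold n_l beyond K: 'X^K at the predecessor of l, or 1 at
    the first K terms of the sequence cofinal in l ([threshold_raise]).

    Conversely, let x be in N_l and b > l. Modifications below l cannot raise
    the threshold n_b arbitrarily: it only looks at the coordinate b - 1 >= l,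
    or at the terms of the sequence cofinal in b, almost all of which are above
    l and outside the supports of x and xi ([threshold_bounded]). So there is K,
    independent of n, such that n x_b(k) + xi_b(k) and - n x_b(k) + xi_b(k) are
    nonnegative for all n and all k >= K. As R is Archimedean, x_b vanishes at
    all k >= K, hence x_b = 0. *)

Set Implicit Arguments.
Unset Strict Implicit.
Unset Printing Implicit Defensive.

Import Order.TTheory GRing.Theory Num.Theory.

Local Open Scope classical_set_scope.
Local Open Scope ring_scope.

(** * Ordinals *)

Lemma osucc_inj : injective osucc.
Proof.
move=> a b e; have le_succ c d : osucc c = osucc d -> (c <= d)%O.
  by move=> cd; rewrite -lt_osucc -cd lt_osucc.
by apply/le_anti; rewrite !le_succ.
Qed.

Lemma oone_le (b : Ord) : (oone <= b)%O = (b != ozero).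
Proof. by rewrite osucc_le lt_neqAle ozero_le andbT eq_sym. Qed.

Lemma Ord_cases (b : Ord) : (oone <= b)%O ->
  [\/ b = oone, exists2 c, (oone <= c)%O & b = osucc c | is_limit b].
Proof.
rewrite oone_le => /eqP b0.
have [[c ->]|ns] := pselect (exists c, b = osucc c); last first.
  by constructor 3; split=> // c e; apply: ns; exists c.
have [->|c0] := eqVneq c ozero; first by constructor 1.
by constructor 2; exists c; rewrite ?oone_le.
Qed.

Lemma countable_ord_le (a b : Ord) : (b <= a)%O -> countable_ord a -> countable_ord b.
Proof.
by move=> ba; apply: sub_countable; apply: subset_card_le => c /= cb; apply: lt_le_trans ba.
Qed.

(** The reason why supports have to be finite: an infinite set of ordinals less
    than a limit b may be cofinal in b. *)
Lemma finite_lt_bound (S : set Ord) (b : Ord) : finite_set S -> b != ozero ->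
  S `<=` [set c | (c < b)%O] ->
  exists2 c, (c < b)%O & forall d, S d -> (d <= c)%O.
Proof.
move=> /finite_seqP[s ->] b0 sb; exists (\big[Order.max/ozero]_(d <- s) d).
  rewrite big_seq; apply: bigmax_lt => [|d /sb //].
  by rewrite lt_neqAle eq_sym b0 ozero_le.
by move=> d ds; apply: le_bigmax_seq.
Qed.

(** * Signs of polynomials at the natural numbers *)

Section Polynomials.
Variable R : realType.
Implicit Types q r : {poly R}.

Lemma poly_ev0_eq0 q (K : nat) :
  (forall k, (K <= k)%N -> q.[k%:R] = 0) -> q = 0.
Proof.
move=> q0; apply/eqP/negPn/negP => nq.
have := @max_poly_roots _ q [seq k%:R | k <- iota K (size q)] nq.
rewrite size_map size_iota ltnn => h; suff: false by []; apply: h.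
- apply/allP => _ /mapP[k + ->]; rewrite mem_iota => /andP[Kk _].
  by apply/rootP; apply: q0.
- by rewrite map_inj_uniq ?iota_uniq // => i j /eqP; rewrite eqr_nat => /eqP.
Qed.

Lemma poly_ev_ge0 q : 0 < lead_coef q ->
  exists K : nat, forall k, (K <= k)%N -> 0 <= q.[k%:R].
Proof.
move=> q0; have [x hx] := polyrcf.poly_pinfty_gt_lc q0.
exists (Num.bound `|x|) => k Kk; apply: le_trans (ltW q0) (hx _ _).
apply: le_trans (ler_norm x) (le_trans (ltW (archi_boundP (normr_ge0 x))) _).
by rewrite ler_nat.
Qed.

(** The real line has no nonzero infinitesimals. *)
Lemma eq0_of_multiples (x y : R) :
  (forall n, (0 < n)%N -> 0 <= x *+ n + y /\ 0 <= - x *+ n + y) -> x = 0.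
Proof.
move=> h; apply/eqP; rewrite -normr_le0 leNgt; apply/negP => x0.
have y0 : 0 <= y.
  have [h1 h2] := h 1%N isT; have := addr_ge0 h1 h2.
  by rewrite addrACA subrr add0r -mulr2n pmulrn_lge0.
have bnd n : `|x| *+ n.+1 <= y.
  have [h1 h2] := h n.+1 isT; rewrite -subr_ge0 addrC -mulNrn.
  by have [_|_] := ger0P x; rewrite ?opprK.
have := bnd (Num.bound (y / `|x|)).
rewrite leNgt => /negP; apply.
rewrite -mulr_natl -ltr_pdivrMr //.
apply: lt_trans (archi_boundP _) _; first by rewrite divr_ge0 // ltW.
by rewrite ltr_nat.
Qed.

(** A coordinate with this property meets the condition that defines the order
    of V_alpha whatever its threshold is. *)
Definition nat_pos q := le1_poly q /\ forall n : nat, 0 <= q.[n%:R].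

Lemma nat_pos0 : nat_pos 0.
Proof. by split=> [|n]; [left|rewrite horner0]. Qed.

Lemma nat_posXn d : nat_pos 'X^d.
Proof.
by split=> [|n]; [right; rewrite lead_coefXn|rewrite hornerXn exprn_ge0 ?ler0n].
Qed.

Lemma lead_coef_addXn q d : (size q <= d)%N -> lead_coef (q + 'X^d) = 1.
Proof. by move=> qd; rewrite lead_coefDr ?lead_coefXn // size_polyXn ltnS. Qed.

Lemma size_mulrn_leq q n : (size (q *+ n) <= size q)%N.
Proof. by rewrite -scaler_nat size_scale_leq. Qed.

End Polynomials.

(** * Infinitesimals modulo a subspace *)

(** A class is positive in X / M iff one of its representatives is, which
    expresses infinitesimality modulo M inside X itself. *)
Lemma infinitesimals_modP (R : realType) (X : povs R) (M : set X) :
  submod_closed (fun x : X => `[< M x >]) -> forall x,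
  infinitesimals_mod M x <-> exists2 xi : X, wedge xi &
    forall n, (0 < n)%N ->
      (exists2 m, M m & wedge (x *+ n + xi + m)) /\
      (exists2 m, M m & wedge (- x *+ n + xi + m)).
Proof.
move=> cM x.
have piE y z : quotmod_pi M y = quotmod_pi M z <-> M (y - z).
  split=> [/eqP|h]; last by apply/eqP; rewrite quotmod_eq (lspan_id cM) asboolT.
  by rewrite quotmod_eq (lspan_id cM) => /asboolP.
have pi0 : quotmod_pi M 0 = 0.
  by rewrite -[X in quotmod_pi _ X](scale0r 0) quotmod_piZ; apply: scale0r.
have piMn y n : quotmod_pi M (y *+ n) = quotmod_pi M y *+ n.
  by elim: n => [|n IH]; rewrite ?mulr0n ?pi0 // !mulrS quotmod_piD IH.
have piN y : quotmod_pi M (- y) = - quotmod_pi M y.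
  by apply/eqP; rewrite -addr_eq0 -quotmod_piD addNr pi0.
have wP y : wedge (quotmod_pi M y : quotient M) <-> exists2 m, M m & wedge (y + m).
  split=> [[z wz /piE h]|[m Mm w]].
    by exists (z - y) => //; rewrite addrC subrK.
  by exists (y + m) => //; apply/piE; rewrite addrC addKr.
split=> [[_ [xi wxi <-] h]|[xi wxi h]].
  exists xi => // n n0; have := h n n0.
  by rewrite -piN -!piMn -!quotmod_piD => -[/wP ? /wP ?].
exists (quotmod_pi M xi); first by exists xi.
move=> n n0; have [h1 h2] := h n n0.
by rewrite /infinitesimals_mod /= -piN -!piMn -!quotmod_piD; split; apply/wP.
Qed.

(** * Vectors of the direct sum *)

Section DirectSumVectors.
Variables (R : realType) (alpha : Ord).
Implicit Types p q : V_space R alpha.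

Lemma coord_range p b : p b != 0 -> (oone <= b <= alpha)%O.
Proof. by case: p => p /= /asboolP[_]; apply. Qed.

Lemma finite_supp p : finite_set [set b | p b != 0].
Proof. by case: p => p /= /asboolP[]. Qed.

Lemma coordMn p n b : (p *+ n) b = p b *+ n.
Proof. by elim: n => [|n IH] //; rewrite !mulrS -IH. Qed.

Definition restrict_fun (s : seq Ord) (f : Ord -> {poly R}) : Ord -> {poly R} :=
  fun b => if (b \in s) && (oone <= b <= alpha)%O then f b else 0.

Lemma restrict_fun_subproof s f : restrict_fun s f \in direct_sum alpha.
Proof.
apply/asboolP; split; last first.
  by move=> b; rewrite /restrict_fun; case: ifP => [/andP[]//|_]; rewrite eqxx.
apply: sub_finite_set (finite_seq s) => b /=.
by rewrite /restrict_fun; case: ifP => [/andP[]//|_]; rewrite eqxx.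
Qed.

Definition restrict s f : V_space R alpha := VSpace (restrict_fun_subproof s f).

Definition single b (q : {poly R}) := restrict [:: b] (fun=> q).

Lemma singleE b (q : {poly R}) c : (oone <= b <= alpha)%O ->
  single b q c = if c == b then q else 0.
Proof.
by rewrite /= /restrict_fun inE; case: eqP => // -> ->.
Qed.

End DirectSumVectors.

(** * The thresholds *)

Section Hierarchy.
Variables (R : realType) (A : Ord -> nat -> Ord).
Hypothesis A_cofinal : forall b, is_limit b -> countable_ord b ->
  cofinal_seq b (A b).
Implicit Types (y : Ord -> {poly R}) (b l : Ord).

Lemma threshold_one y : threshold A oone y = +oo%E.
Proof. by rewrite /threshold eqxx. Qed.

Lemma threshold_succ y b : (oone <= b)%O -> threshold A (osucc b) y = edeg (y b).
Proof.
move=> b1; rewrite /threshold ifF; last by rewrite gt_eqF // lt_osucc.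
case: pselect => [e|[]]; last by exists b.
by case: cid => c /= /osucc_inj ->.
Qed.

Lemma threshold_limit y b : is_limit b -> threshold A b y =
  ereal_inf [set n%:R%:E | n in [set n | (0 < n)%N /\ y (A b n) = 0]].
Proof.
move=> [_ ns]; rewrite /threshold ifF; last by apply/eqP/ns.
by case: pselect => // -[c e]; case: (ns c).
Qed.

(** As the size of a polynomial is one more than its degree, s majorizes the
    degrees of the coordinates of y of index at least l. The coordinates of y
    below l are arbitrary: they are the ones that matter only modulo M_l. *)
Lemma threshold_bounded l b (s : Ord -> nat) :
  (oone <= l < b)%O -> countable_ord b -> finite_set [set c | s c != 0%N] ->
  exists K : nat, forall y, (forall c, (l <= c)%O -> (size (y c) <= s c)%N) ->
    (threshold A b y <= K%:R%:E)%E.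
Proof.
move=> /andP[l1 lb] cb fs; have b1 := ltW (le_lt_trans l1 lb).
have [e|[c c1 e]|lim] := Ord_cases b1.
- by rewrite e ltNge l1 in lb.
- exists (s c) => y ys; rewrite e threshold_succ // edegE.
  have := ys c; rewrite -lt_osucc -e => /(_ lb).
  by case: (size _) => [|m ms]; rewrite ?leNye // lee_fin ler_nat ltnW.
have [Abnd Amono Acof] := A_cofinal lim cb.
(* The cofinal sequence of b eventually exceeds both l and the part of the
   support of s that lies below b; y vanishes at its terms from there on. *)
have [|||c cb' sc] :=
  @finite_lt_bound (l |` ([set c | s c != 0%N] `&` [set c | (c < b)%O])) b.
- by rewrite finite_setU; split=> //; apply: finite_setI; left.
- by rewrite -oone_le.
- by move=> c [-> //|[]].
have [n n0 cn] := Acof c cb'; exists n.+1 => y ys.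
rewrite threshold_limit //; apply: ereal_inf_lbound; exists n.+1 => //; split=> //.
have lt : (c < A b n.+1)%O by apply: le_lt_trans cn (Amono _ _ _); rewrite n0 ltnSn.
apply/eqP; rewrite -size_poly_eq0 -leqn0.
have <- : s (A b n.+1) = 0%N.
  apply/eqP/negPn/negP => ns; move: lt; rewrite ltNge sc //; right; split=> //=.
  by have /andP[] := Abnd n.+1 isT.
by apply: ys; apply: le_trans (ltW lt); apply: sc; left.
Qed.

Variable alpha : Ord.
Hypothesis alpha_countable : countable_ord alpha.

(** The vector r is positive, as is any vector obtained from it by adding at l a
    polynomial with positive leading coefficient that is nonnegative at the
    integers from K on. *)
Lemma threshold_raise l (K : nat) : (oone <= l <= alpha)%O ->
  exists r : V_space R alpha, [/\ forall b, (l <= b)%O -> r b = 0,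
    forall b, nat_pos (r b) &
    forall y, (forall b, (b < l)%O -> y b = r b) -> (K%:R%:E <= threshold A l y)%E].
Proof.
move=> /andP[l1 la].
have [->|[c c1 e]|lim] := Ord_cases l1.
- exists 0; split=> // [b|y _]; first exact: nat_pos0.
  by rewrite threshold_one leey.
- have lc : (c < l)%O by rewrite e lt_osucc.
  have hc : (oone <= c <= alpha)%O by rewrite c1 (le_trans (ltW lc)).
  exists (single alpha c 'X^K); split=> [b lb|b|y yr].
  + by rewrite singleE // gt_eqF // (lt_le_trans lc).
  + by rewrite singleE //; case: ifP => _; [exact: nat_posXn|exact: nat_pos0].
  + by rewrite e threshold_succ // yr // singleE // eqxx edegE size_polyXn.
have [Abnd Amono _] := A_cofinal lim (countable_ord_le la alpha_countable).
exists (restrict alpha [seq A l n | n <- iota 1 K] (fun=> 1)); split=> [b lb|b|y yr].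
- rewrite /= /restrict_fun; case: ifP => // /andP[/mapP[n + e] _].
  rewrite mem_iota => /andP[n0 _]; have /andP[_] := Abnd n n0.
  by rewrite -e ltNge lb.
- rewrite /= /restrict_fun; case: ifP => _; last exact: nat_pos0.
  by have := nat_posXn R 0; rewrite expr0.
rewrite threshold_limit //; apply: le_ereal_inf_tmp => _ [n [n0 yn] <-].
rewrite lee_fin ler_nat leqNgt; apply/negP => nK.
have /andP[An1 Anl] := Abnd n n0.
move: yn; rewrite yr //= /restrict_fun An1 (le_trans (ltW Anl) la) !andbT map_f.
  by move/eqP; rewrite oner_eq0.
by rewrite mem_iota n0 add1n ltnS ltnW.
Qed.

(** * The hierarchy of infinitesimals *)

Notation X := (V R A alpha).

Definition supp_lt l : set X :=
  [set p | forall b, (l <= b)%O -> (p : V_space R alpha) b = 0].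

Definition supp_le l : set X :=
  [set p | forall b, (l < b)%O -> (p : V_space R alpha) b = 0].

(** A vector supported below l is supported below some g < l, even when l is a
    limit, because its support has a greatest element. *)
Lemma M_iter_supp l : (oone <= l)%O ->
  (forall g, (g < l)%O -> N_iter X g = supp_le g) ->
  M_iter X l = supp_lt l.
Proof.
move=> l1 IH; apply/seteqP; split=> p.
  move=> [g /= gl]; rewrite IH // => pg b lb; apply: pg; exact: lt_le_trans lb.
move=> pl; have [||g gl gp] := finite_lt_bound (finite_supp p) (b := l).
- by rewrite -oone_le.
- by move=> b /= pb; rewrite ltNge; apply: contraNN pb => /pl ->.
exists g => //; rewrite IH // => b gb; apply/eqP/negPn/negP => /gp.
by rewrite leNgt gb.
Qed.

(** The monomial 'X^(size q) dominates all multiples of the l-th coordinate q of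
    p, as in the lexicographic order on polynomials. *)
Lemma infinitesimals_mod_supp_le l p : (oone <= l <= alpha)%O ->
  submod_closed (fun x : X => `[< supp_lt l x >]) ->
  supp_le l p -> infinitesimals_mod (supp_lt l) p.
Proof.
move=> hl cM pl; have [l1 la] := andP hl; apply/(infinitesimals_modP cM).
have single_wedge (q : {poly R}) : nat_pos q -> V_wedge A (single alpha l q).
  move=> [q1 qn] b _; rewrite singleE //; case: ifP => _; first by split.
  by split=> [|n _ _]; [left|rewrite horner0].
set q := (p : V_space R alpha) l.
pose xi : V_space R alpha := single alpha l 'X^(size q).
exists (xi : X); first exact/single_wedge/nat_posXn.
(* Only the coordinates below l of the representative w of z are chosen; the
   l-th one is imposed by z and becomes admissible once the threshold is large. *)
have lead_wedge (z : V_space R alpha) : supp_le l z -> 0 < lead_coef (z l) ->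
    exists2 m : X, supp_lt l m & @wedge R X ((z : X) + m).
  move=> zl /[dup] z0 /poly_ev_ge0[K hK].
  have [r [rl rpos rK]] := threshold_raise K hl.
  pose w : V_space R alpha := r + single alpha l (z l).
  have wE b : w b = if b == l then z l else r b.
    rewrite [LHS](_ : _ = r b + single alpha l (z l) b) // singleE //.
    by case: eqP => [->|_]; rewrite ?addr0 // rl ?add0r ?lexx.
  exists (w - z).
    move=> b lb; rewrite [LHS](_ : _ = w b - z b) // wE.
    case: eqVneq => [->|nbl]; first by rewrite subrr.
    by rewrite rl // zl ?subr0 // lt_neqAle eq_sym nbl.
  rewrite addrC subrK => b hb; rewrite wE.
  case: eqP => [->|_]; last by have [h1 h2] := rpos b; split=> // n _ _; exact: h2.
  split=> [|n _ tn]; first by right.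
  apply: hK; rewrite -(ler_nat R) -lee_fin; apply: le_trans tn.
  by apply: rK => b' b'l; rewrite wE lt_eqF.
have mulrn_wedge (z : V_space R alpha) n : supp_le l z -> (size (z l) <= size q)%N ->
    exists2 m : X, supp_lt l m & @wedge R X ((z : X) *+ n + (xi : X) + m).
  move=> zl zq; apply: (lead_wedge (z *+ n + xi)).
    move=> b lb; rewrite [LHS](_ : _ = (z *+ n) b + xi b) // coordMn zl //.
    by rewrite mul0rn add0r singleE // gt_eqF.
  have -> : (z *+ n + xi) l = (z *+ n) l + xi l by [].
  rewrite coordMn singleE // eqxx.
  by rewrite lead_coef_addXn ?ltr01 // (leq_trans (size_mulrn_leq _ _)).
move=> n n0; split; apply: mulrn_wedge => //.
  by move=> b lb; rewrite [LHS](_ : _ = - (p : V_space R alpha) b) // pl // oppr0.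
by have -> : (- (p : V_space R alpha)) l = - q by []; rewrite size_polyN.
Qed.

(** At b > l the inequalities hold from an integer independent of the multiple
    n, which leaves no room for a nonzero coordinate. *)
Lemma supp_le_infinitesimals_mod l p : (oone <= l <= alpha)%O ->
  submod_closed (fun x : X => `[< supp_lt l x >]) ->
  infinitesimals_mod (supp_lt l) p -> supp_le l p.
Proof.
move=> /andP[l1 la] cM /(infinitesimals_modP cM)[xi _ h] b lb.
apply/eqP/negPn/negP => pb; move: (pb); apply/negP/negPn/eqP.
have hb := coord_range pb; have [_ ba] := andP hb.
pose P : V_space R alpha := p; pose Xi : V_space R alpha := xi.
pose s c := maxn (size (P c)) (size (Xi c)).
have [||K hK] := @threshold_bounded l b s _ (countable_ord_le ba alpha_countable).
- by rewrite l1.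
- apply: sub_finite_set (_ : _ `<=` [set c | P c != 0] `|` [set c | Xi c != 0]) _.
    move=> c /=; rewrite /s; have [->|] := eqVneq (P c) 0; last by left.
    by rewrite size_poly0 max0n size_poly_eq0; right.
  by rewrite finite_setU; split; apply: finite_supp.
(* Evaluation points start at 1, since the order ignores the value at 0. *)
have ev (z : V_space R alpha) n k : (forall c, size (z c) = size (P c)) ->
    (maxn 1 K <= k)%N ->
    (exists2 m : X, supp_lt l m & @wedge R X ((z : X) *+ n + xi + m)) ->
    0 <= (z b).[k%:R] *+ n + (Xi b).[k%:R].
  move=> zP; rewrite geq_max => /andP[k0 Kk] [m ml w].
  have yE c : (l <= c)%O ->
      ((z : X) *+ n + xi + m : V_space R alpha) c = z c *+ n + Xi c.
    move=> lc; rewrite [LHS](_ : _ = (z *+ n) c + Xi c + (m : V_space R alpha) c) //.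
    by rewrite coordMn ml // addr0.
  have [_ /(_ k k0)] := w b hb.
  rewrite yE ?(ltW lb) // hornerD hornerMn; apply.
  apply: le_trans (hK _ _) _; last by rewrite lee_fin ler_nat.
  move=> c lc; rewrite yE // (leq_trans (size_polyD _ _)) // geq_max.
  by rewrite /s leq_maxr andbT leq_max (leq_trans (size_mulrn_leq _ _)) // zP.
apply: (@poly_ev0_eq0 _ _ (maxn 1 K)) => k Kk.
apply: (@eq0_of_multiples _ _ (Xi b).[k%:R]) => n n0; have [h1 h2] := h n n0.
split; first exact: ev h1.
rewrite -hornerN; apply: (ev (- P)) h2 => // c.
by have -> : (- P) c = - P c by []; rewrite size_polyN.
Qed.

Lemma N_iter_supp l : (l <= alpha)%O -> N_iter X l = supp_le l.
Proof.
elim: l / (Ord_lt_wf l) => l _ IH la.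
have [->|l0] := eqVneq l ozero.
  rewrite N_iter0; apply/seteqP; split=> [p -> //|p p0 /=].
  apply: val_inj; apply/funext => b /=; apply/eqP/negPn/negP => pb.
  move: (pb); rewrite p0 ?eqxx //; have /andP[+ _] := coord_range pb.
  by rewrite osucc_le.
have l1 : (oone <= l)%O by rewrite oone_le.
have ME := M_iter_supp l1 (fun g gl => IH g gl (le_trans (ltW gl) la)).
have gt0 : (ozero < l)%O by rewrite -osucc_le.
have cM := M_iter_submod X gt0; rewrite ME in cM.
rewrite N_iter_gt0 // ME; apply/seteqP; split=> p.
  by apply: supp_le_infinitesimals_mod => //; rewrite l1.
by apply: infinitesimals_mod_supp_le => //; rewrite l1.
Qed.

End Hierarchy.

Theorem theorem4p1 (R : realType) (A : Ord -> nat -> Ord)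
    (A_cofinal : forall b : Ord, is_limit b -> countable_ord b ->
      cofinal_seq b (A b))
    (alpha : Ord) (alpha_ge1 : (oone <= alpha)%O)
    (alpha_countable : countable_ord alpha) :
  is_aa_type (V R A alpha) alpha.
Proof.
have NE := N_iter_supp R A_cofinal alpha_countable; split=> [|m ma].
  apply/seteqP; split; last by apply: N_iter_mono; rewrite ltW // lt_osucc.
  move=> p _; rewrite NE // => b ab; apply/eqP/negPn/negP => /coord_range/andP[_].
  by rewrite leNgt ab.
rewrite !NE ?osucc_le ?(ltW ma) //.
have hm : (oone <= osucc m <= alpha)%O.
  by rewrite osucc_le ma andbT osucc_le lt_osucc ozero_le.
have mm : (m < osucc m)%O by rewrite lt_osucc.
move=> /seteqP[/(_ (single alpha (osucc m) 1)) + _] => /(_ _ _ mm) h.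
have /eqP : single alpha (osucc m) (1 : {poly R}) (osucc m) = 0.
  apply: h => b mb; rewrite singleE // gt_eqF //.
by rewrite singleE // eqxx oner_eq0.
Qed.
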